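(* Consider two-way hashing with $n$ bins into which $m=sn/2$ items are inserted one at a time, $s>0$ a constant, using the depth-$h$ insertion algorithm described in the context, where $h$ is an integer with $1\le h<\log\log n$. For every constant $c>0$ there is a constant $C$ such that, with probability $1-O(1/n^c)$, no insertion leads to a bin with load more than $$6\,\frac{\log\log n}{h\,\log(\log\log n/h)}+C.$$
   Context: $\log$ is base $2$. Each item is associated with two distinct bins, its pair chosen independently and uniformly at random among the $\binom{n}{2}$ pairs of distinct bins, and is stored in one of them. Orient the edge of each stored item from the bin not holding it towards the bin holding it; the load of a bin is the number of items stored in it (its in-degree). Depth-$h$ insertion algorithm: to insert an item with bins $U_1,U_2$, perform a breadth-first backward search to depth $h$ from both $U_1$ and $U_2$, where from a bin $X$ one goes to every bin $Y$ such that there is a directed edge $Y\to X$ (an item stored in $X$ whose other bin is $Y$). Among all visited bins choose one, $W$, of minimum load; if $W$ is reached from, say, $U_1$ along $U_1=X_0,X_1,\dots,X_k=W$ ($k\le h$) with directed edges $X_{j+1}\to X_j$, place the new item in $U_1$ and for each $j$ move the item on edge $X_{j+1}\to X_j$ from $X_j$ to $X_{j+1}$, so that at most $h$ moves are made and only the load of $W$ increases, by one. *)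

(* Defs.v *)
From mathcomp Require Import all_boot all_order all_algebra.
From mathcomp Require Import all_classical all_reals all_analysis.

Set Implicit Arguments.
Unset Strict Implicit.
Unset Printing Implicit Defensive.

Import Order.TTheory GRing.Theory Num.Theory.

Definition bin_pair (n : nat) := {e : {set 'I_n} | #|e| == 2}.

(* A state lists the stored items in order of insertion.  The item (Y, X) has
   bins X and Y and is stored in X: it is the directed edge Y -> X.  Items are
   referred to by their position in the list, as several of them may have the
   same pair of bins. *)
Definition state (n : nat) := seq ('I_n * 'I_n).

Definition load n (a : state n) (X : 'I_n) : nat := count (fun e => e.2 == X) a.

(* [trail a X s Y]: the items at positions s = [:: i_0; ...; i_(k-1)] form a
   backward walk X = X_0, ..., X_k = Y, where i_j is an edge X_(j+1) -> X_j. *)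
Inductive trail n (a : state n) : 'I_n -> seq nat -> 'I_n -> Prop :=
| trail_nil X : trail a X [::] X
| trail_cons X Y Z i s :
    onth a i = Some (Y, X) -> trail a Y s Z -> trail a X (i :: s) Z.

(* The bins visited by the backward breadth-first search to depth h from X. *)
Definition visited n (h : nat) (a : state n) (X Y : 'I_n) : Prop :=
  exists2 s, size s <= h & trail a X s Y.

(* A breadth-first search from X reaches Y along a shortest path. *)
Definition bfs_path n (a : state n) (X : 'I_n) (s : seq nat) (Y : 'I_n) : Prop :=
  trail a X s Y /\ forall s', trail a X s' Y -> size s <= size s'.

Definition move n (s : seq nat) (a : state n) : state n :=
  [seq if p.1 \in s then (p.2.2, p.2.1) else p.2
     | p <- zip (iota 0 (size a)) a].

(* a' is a possible outcome of inserting an item with pair e in the state a;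
   U is the endpoint of e that receives the item, V the other one.  The choice
   of the least loaded bin W and of the path leading to it is left open. *)
Definition insertion n (h : nat) (a : state n) (e : bin_pair n)
    (a' : state n) : Prop :=
  exists U V W s,
    [/\ val e = [set U; V],
        size s <= h /\ bfs_path a U s W,
        forall X Y, X \in val e -> visited h a X Y -> load a W <= load a Y
      & a' = rcons (move s a) (V, U)].

(* All ways of breaking ties are covered: as a state keeps the items in order
   of insertion, A may base its choices on the whole past. *)
Definition insertion_algorithm n (h : nat)
    (A : state n -> bin_pair n -> state n) : Prop :=
  forall a e, insertion h a e (A a e).

Definition run n (A : state n -> bin_pair n -> state n)
  (w : seq (bin_pair n)) : state n := foldl A [::] w.

(* Uniform probability; on m.-tuple (bin_pair n) it makes the m pairs
   independent and each of them uniform. *)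
Definition Prob (R : realType) (T : finType) (E : pred T) : R :=
  (#|E|%:R / #|T|%:R)%R.

Definition log2 (R : realType) (x : R) : R := (ln x / ln 2)%R.

Definition max_load_bound (R : realType) (n h : nat) (C : R) : R :=
  let ll : R := log2 (log2 n%:R) in
  (6 * (ll / (h%:R * log2 (ll / h%:R))) + C)%R.

Definition all_loads_le (R : realType) n m (A : state n -> bin_pair n -> state n)
    (B : R) (w : m.-tuple (bin_pair n)) : bool :=
  [forall t : 'I_m.+1, forall X : 'I_n,
     ((load (run A (take t w)) X)%:R <= B)%R].

(* Main.v *)
(* Loads never decrease, so only the final state matters.  Let [T] be a cluster
   of bins of load at least [l0], closed under adjacency among such bins, around
   an overloaded bin, and let [N l] be the number of its bins of load at least
   [l].  When a bin rises from load [l] to [l.+1], every bin found by the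
   backward searches from both ends of the new item has load at least [l] and
   lies in [T].  With high probability every set [Q] of at most log n bins
   contains at most [#|Q| + t] items, so these searches branch about [l / 2]
   times at each of their [h] levels without overlapping much, and
   [N l >= (l / O(1))^h * N l.+1].  On the other hand [T] has fewer than log n
   bins: a set of about log n bins containing at least one item less than its
   size touches with high probability fewer than [l0] items per bin.  Thus, for
   every [b], a load of at least [l0 + O(b) + d] forces [b^(h d) < log n].

   Both probabilistic facts are first-moment bounds in which connectivity is
   used only through the number of items inside the set. *)
Require Import Defs.
From mathcomp Require Import all_boot all_order all_algebra.
From mathcomp Require Import all_classical all_reals all_analysis.
From mathcomp Require Import zify lra ring.

Set Implicit Arguments.
Unset Strict Implicit.
Unset Printing Implicit Defensive.
Import Order.TTheory GRing.Theory Num.Theory.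

(** * Loads under an insertion *)

Lemma onth_some (T : Type) (x0 : T) (s : seq T) i :
  i < size s -> onth s i = Some (nth x0 s i).
Proof. by move=> si; rewrite onthE (nth_map x0). Qed.

Lemma onth_move n s (a : state n) i :
  onth (move s a) i =
  if onth a i is Some e then Some (if i \in s then (e.2, e.1) else e) else None.
Proof.
have sz : size (zip (iota 0 (size a)) a) = size a.
  by rewrite size_zip size_iota minnn.
case: (ltnP i (size a)) => ia; last first.
  by rewrite !onth_default // size_map sz.
case: a sz ia => // e0 a sz ia.
rewrite (onth_some e0 ia) (onth_some e0) ?size_map ?sz //.
rewrite (nth_map (0, e0)) ?sz // nth_zip ?size_iota //.
by rewrite [(_, _).1]/= nth_iota.
Qed.

Lemma loadE n m (a : state n) X : size a <= m ->
  load a X = #|[set i : 'I_m | if onth a i is Some e then e.2 == X else false]|.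
Proof.
move=> am; rewrite -sum1_card /load -sum1_count.
case: a am => [|e0 a] am.
  by rewrite big_nil big_pred0 // => i; rewrite inE onth0n.
rewrite (big_nth e0) big_mkord.
rewrite (big_ord_widen_cond m (fun i => (nth e0 (e0 :: a) i).2 == X) (fun=> 1)) //.
apply: eq_bigl => i; rewrite inE.
by case: ltnP => ia; [rewrite (onth_some e0 ia) andbT|rewrite onth_default ?andbF].
Qed.

Lemma trail_cons_inv n (a : state n) X i s Z : trail a X (i :: s) Z ->
  exists2 Y, onth a i = Some (Y, X) & trail a Y s Z.
Proof. by inversion 1; subst; eexists; eauto. Qed.

Lemma trail_cat_inv n (a : state n) X s1 s2 Z :
  trail a X (s1 ++ s2) Z -> exists2 Y, trail a X s1 Y & trail a Y s2 Z.
Proof.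
elim: s1 X => [|i s1 IH] X /=; first by exists X => //; constructor.
move=> /trail_cons_inv[Y' oi /IH[Y t1 t2]].
by exists Y => //; econstructor; eauto.
Qed.

Lemma trail_cat n (a : state n) X s1 s2 Y Z :
  trail a X s1 Y -> trail a Y s2 Z -> trail a X (s1 ++ s2) Z.
Proof.
by move=> t1 t2; elim: t1 t2 => //= ? ? ? ? ? e _ IH /IH; econstructor; eauto.
Qed.

(** An edge determines its head, so a repeated position would bring the walk back to the same bin,
    and cutting out the loop would shorten it. *)
Lemma bfs_uniq n (a : state n) X s Z : bfs_path a X s Z -> uniq s.
Proof.
move=> [tr min]; apply: contraT => /uniqPn -/(_ 0) [i [j [ij js eqij]]].
have {}js : j < size s by [].
have is_ : i < size s by lia.
have := tr; rewrite -{1}(cat_take_drop i s) (drop_nth 0 is_).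
move=> /trail_cat_inv[Y t1 t2].
have := tr; rewrite -{1}(cat_take_drop j s) (drop_nth 0 js) -eqij.
move=> /trail_cat_inv[Y' t1' t2'].
have YY' : Y = Y'.
  have [? oi _] := trail_cons_inv t2; have [? + _] := trail_cons_inv t2'.
  by rewrite oi => -[].
move: t2'; rewrite -YY' => /(trail_cat t1) /min.
by rewrite size_cat /= size_take size_drop is_; lia.
Qed.

Lemma trail_lt n (a : state n) X s Z : trail a X s Z -> {in s, forall i, i < size a}.
Proof.
elim=> // Y1 Y2 Y3 i s' ons _ IH j; rewrite inE => /orP[/eqP ->|/IH //].
by rewrite -onthTE ons.
Qed.

(** Reversing X_(j+1) -> X_j shifts one unit of load from X_j to X_(j+1); along the trail this
    telescopes to a shift from [U] to [W]. Distinct positions make the sum over [s] count each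
    reversed item once. *)
Lemma move_load n (a : state n) U s W Z : trail a U s W -> uniq s ->
  load (move s a) Z + (U == Z) = load a Z + (W == Z).
Proof.
move=> tr us.
have ltsa := trail_lt tr.
pose f b i :=
  if onth a i is Some e then nat_of_bool ((if b then e.1 else e.2) == Z) else 0.
have loadf (b : state n) (g : nat -> nat) : size b = size a ->
    (forall i, i < size a ->
       g i = (if onth b i is Some e then nat_of_bool (e.2 == Z) else 0)) ->
    load b Z = \sum_(i <- iota 0 (size a)) g i.
  move=> sb gb; rewrite /load -sum1_count -sb.
  case: b sb gb => [|e0 b] sb gb; first by rewrite big_nil /= big_nil.
  rewrite (big_nth e0) big_mkcond /index_iota subn0.
  rewrite big_seq [RHS]big_seq; apply: eq_bigr => i; rewrite mem_iota add0n => /andP[_ ia].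
  by rewrite gb -?sb // (onth_some e0) //; case: (_ == _).
have splitS g : \sum_(i <- iota 0 (size a)) g i =
    \sum_(i <- s) g i + \sum_(i <- iota 0 (size a) | i \notin s) g i.
  rewrite (bigID (mem s)) /=; congr (_ + _); rewrite -big_filter; apply: perm_big.
  apply: uniq_perm => //; first by rewrite filter_uniq ?iota_uniq.
  move=> i; rewrite mem_filter mem_iota /= add0n.
  by case: (boolP (i \in s)) => // /ltsa ->.
have szm : size (move s a) = size a by rewrite size_map size_zip size_iota minnn.
rewrite (loadf a (f false)) //.
rewrite (loadf (move s a) (fun i => f (i \in s) i)) //; last first.
  by move=> i _; rewrite onth_move /f; case: (onth a i) => // e; case: (_ \in _).
rewrite !splitS.
have -> : \sum_(i <- iota 0 (size a) | i \notin s) f (i \in s) i =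
   \sum_(i <- iota 0 (size a) | i \notin s) f false i.
  by apply: eq_bigr => i /negPf ->.
have -> : \sum_(i <- s) f (i \in s) i = \sum_(i <- s) f true i.
  by rewrite big_seq [RHS]big_seq; apply: eq_bigr => i ->.
suff : \sum_(i <- s) f true i + (U == Z) = \sum_(i <- s) f false i + (W == Z) by lia.
rewrite {us ltsa loadf splitS szm}; elim: tr => [X|X Y Z' i s' oi _ IH].
  by rewrite !big_nil.
rewrite !big_cons; have -> : f true i = (Y == Z) by rewrite /f oi.
have -> : f false i = (X == Z) by rewrite /f oi.
by move: IH; lia.
Qed.

(** The moves take one unit from [U] and add one to [W]; the new item gives [U] its unit back.
    Reversing an item keeps its pair of bins. *)
Lemma insertion_step n h (a : state n) e a' : insertion h a e a' ->
  exists U V W, [/\ val e = [set U; V], visited h a U W,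
    forall X Y, X \in val e -> visited h a X Y -> load a W <= load a Y,
    forall Z, load a' Z = load a Z + (W == Z)
    & size a' = (size a).+1 /\ forall i x y, onth a' i = Some (y, x) ->
      [\/ i = size a /\ val e = [set y; x], onth a i = Some (y, x)
        | onth a i = Some (x, y)]].
Proof.
move=> [U [V [W [s [eUV [sh bfs] min ->]]]]]; exists U, V, W.
have szm : size (move s a) = size a by rewrite size_map size_zip size_iota minnn.
split=> //.
- by exists s => //; case: bfs.
- move=> Z; rewrite /load -cats1 count_cat /= addn0.
  exact: move_load bfs.1 (bfs_uniq bfs).
- rewrite size_rcons szm; split=> // i x y.
  rewrite -cats1 onth_cat szm; case: ltnP => ia.
    rewrite onth_move; case: (onth a i) => // -[y' x'].
    by case: (_ \in _) => -[<- <-]; [apply: Or33|apply: Or32].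
  have [->|] := eqVneq i (size a).
    by rewrite subnn /= => -[<- <-]; apply: Or31; rewrite finset.setUC.
  by move=> ne; rewrite onth_default //=; lia.
Qed.

(** * Growth of the number of loaded bins *)

(** Forgets how choices are made: the deterministic part holds for every sequence of legal
    insertions. *)
Definition history n m h (w : m.-tuple (bin_pair n)) (a : nat -> state n) : Prop :=
  a 0 = [::] /\ forall i : 'I_m, insertion h (a i) (tnth w i) (a i.+1).

Lemma history_load n m h (w : m.-tuple (bin_pair n)) a : history h w a ->
  forall i j X, i <= j -> j <= m -> load (a i) X <= load (a j) X.
Proof.
move=> [_ ha] i j X; elim: j => [|j IH] ij jm.
  by move: ij; rewrite leqn0 => /eqP ->.
have [->//|ne] := eqVneq i j.+1.
apply: leq_trans (IH _ (ltnW jm)) _; first by lia.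
by have [U [V [W [_ _ _ -> _]]]] := insertion_step (ha (Ordinal jm)); exact: leq_addr.
Qed.

(** Whatever their orientation, positions name the same items in states taken at different times. *)
Lemma history_items n m h (w : m.-tuple (bin_pair n)) a : history h w a ->
  forall i, i <= m -> size (a i) = i /\
    forall (j : 'I_m) x y, onth (a i) j = Some (y, x) -> val (tnth w j) = [set y; x].
Proof.
move=> [a0 ha]; elim=> [|i IH] im; first by rewrite a0; split=> // j x y; rewrite onth0n.
have [sai ends] := IH (ltnW im).
have [U [V [W [_ _ _ _ [-> step]]]]] := insertion_step (ha (Ordinal im)).
rewrite sai; split=> // j x y /step[[ji <-]|/ends//|/ends ->]; last by rewrite finset.setUC.
by congr (val (tnth w _)); apply: val_inj; rewrite /= ji.
Qed.

Lemma history_raise n m h (w : m.-tuple (bin_pair n)) a l Y : history h w a ->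
  l < load (a m) Y ->
  exists i : 'I_m, exists2 U, U \in val (tnth w i) &
   [/\ visited h (a i) U Y,
     forall X Z, X \in val (tnth w i) -> visited h (a i) X Z -> l <= load (a i) Z
   & forall Z, load (a i.+1) Z = load (a i) Z + (Y == Z)].
Proof.
move=> [a0 ha] lY.
have exj : exists j, l < load (a j) Y by exists m.
(* When the load of [Y] first exceeds [l], it rises from exactly [l], so [Y] is the least loaded
   visited bin. *)
case: (ex_minnP exj) => -[|i] li mini; first by move: li; rewrite a0.
have im : i < m by exact: mini.
have [U [V [W [eUV vW minW ld _]]]] := insertion_step (ha (Ordinal im)).
have {mini} : ~~ (l < load (a i) Y) by apply/negP => /mini; rewrite ltnn.
move: li; rewrite ld /=; case: (eqVneq W Y) => [WY|_]; last by rewrite addn0 => ->.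
move=> li li'; have {li li'}lE : load (a i) Y = l by lia.
exists (Ordinal im), U; first by rewrite eUV !inE eqxx.
by split; rewrite -?lE -?WY.
Qed.

Lemma visited0 n h (a : state n) X : visited h a X X.
Proof. by exists [::] => //; constructor. Qed.

Lemma visitedS n h (a : state n) i X Y Z :
  onth a i = Some (Y, X) -> visited h a Y Z -> visited h.+1 a X Z.
Proof. by move=> oi [s sh tr]; exists (i :: s) => //; econstructor; eauto. Qed.

Definition high n (a : state n) (T : {set 'I_n}) l : {set 'I_n} :=
  [set X in T | l <= load a X].

Definition inside n m (w : m.-tuple (bin_pair n)) (Q : {set 'I_n}) : {set 'I_m} :=
  [set i | val (tnth w i) \subset Q].

(* The time [i] may depend on the bin [p]: the orientation of the items changes,
   but the bounds on the loads persist. *)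
Definition roots n m (a : nat -> state n) (T : {set 'I_n}) l j : {set 'I_n} :=
  [set p | [exists i : 'I_m,
     `[< forall q, visited j (a i) p q -> l <= load (a i) q /\ q \in T >]]].

Lemma roots_sub n m (a : nat -> state n) (T : {set 'I_n}) l j :
  roots m a T l j \subset T.
Proof.
by apply/fintype.subsetP => p; rewrite inE => /existsP[i /asboolP/(_ p (visited0 _ _ _))[]].
Qed.

(** Double counting of the pairs (p, e) with e in [E p]. *)
Lemma sum_card_overlap (I J : finType) (Q : {set I}) (E : I -> {set J}) (F : {set J}) c :
  (forall p, p \in Q -> E p \subset F) ->
  (forall e, #|[set p in Q | e \in E p]| <= c) ->
  \sum_(p in Q) #|E p| <= #|F| * c.
Proof.
move=> EF Ec.
have -> : \sum_(p in Q) #|E p| = \sum_(p in Q) \sum_(e in F) (e \in E p).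
  apply: eq_bigr => p pQ; rewrite -sum1_card -big_mkcondr /=.
  by apply: eq_bigl => e; rewrite andb_idl // => /(fintype.subsetP (EF p pQ)).
rewrite exchange_big -sum_nat_const; apply: leq_sum => e _.
rewrite -big_mkcondr sum1_card; apply: leq_trans (Ec e).
by apply: subset_leq_card; apply/fintype.subsetP => p; rewrite inE.
Qed.

(** Let Q and Q' be the roots of depths j+1 and j. Each p in Q holds at least l items at its own
    time, and their other bins lie in Q', since the search from p contains theirs. So at least |Q| l
    / 2 items are inside the union of Q and Q', while sparsity allows |Q| + |Q'| + t; for Q
    nonempty, t <= t |Q|. *)
Lemma roots_grow n m h (w : m.-tuple (bin_pair n)) a (T : {set 'I_n}) t l j :
  history h w a ->
  (forall Q : {set 'I_n}, Q \subset T -> #|inside w Q| <= #|Q| + t) ->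
  #|roots m a T l j.+1| * (l - t.+1.*2) <= #|roots m a T l j|.*2.
Proof.
move=> ha sparse; set Q := roots m a T l j.+1; set Q' := roots m a T l j.
have [->|[p0 p0Q]] := set_0Vmem Q; first by rewrite cards0.
have [i0 _] : exists i0 : 'I_m, True.
  by move: p0Q; rewrite inE => /existsP[i0]; exists i0.
have Q0 : 0 < #|Q| by apply/card_gt0P; exists p0.
pose good (p : 'I_n) (i : 'I_m) :=
  `[< forall q, visited j.+1 (a i) p q -> l <= load (a i) q /\ q \in T >].
pose tau p := odflt i0 [pick i | good p i].
have tauP p : p \in Q -> forall q, visited j.+1 (a (tau p)) p q ->
    l <= load (a (tau p)) q /\ q \in T.
  rewrite inE => /existsP[i gi]; rewrite /tau; case: pickP => [i' /asboolP//|/(_ i)].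
  by rewrite /good gi.
pose Ep p := [set e : 'I_m | if onth (a (tau p)) e is Some f then f.2 == p else false].
have EpI p e : e \in Ep p -> exists q, onth (a (tau p)) e = Some (q, p).
  rewrite inE; case E: (onth _ _) => [[q p']|] //= /eqP pE.
  by exists q; rewrite -pE.
have hi (i : 'I_m) := history_items ha (ltnW (ltn_ord i)).
have Epl p : p \in Q -> l <= #|Ep p|.
  move=> pQ; rewrite -loadE; last by rewrite (hi _).1 ltnW.
  by have [] := tauP p pQ p (visited0 _ _ _).
have Epw p e : e \in Ep p ->
    exists q, onth (a (tau p)) e = Some (q, p) /\ val (tnth w e) = [set q; p].
  by move=> /EpI[q oq]; exists q; split=> //; exact: (hi (tau p)).2 oq.
pose E := \bigcup_(p in Q) Ep p.
have EQ : E \subset inside w (Q :|: Q').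
  apply/finset.bigcupsP => p pQ; apply/fintype.subsetP => e /Epw[q [oq wq]].
  rewrite inE wq; apply/fintype.subsetP => z; rewrite !inE => /orP[/eqP ->|/eqP ->].
    apply/orP; right; apply/existsP; exists (tau p); apply/asboolP => z' vz'.
    exact: tauP (visitedS oq vz').
  by move: pQ; rewrite inE => ->.
(* An item has two bins, so it enters at most two bins of [Q]. *)
have lQE : #|Q| * l <= #|E|.*2.
  rewrite -sum_nat_const -muln2.
  apply: (@leq_trans (\sum_(p in Q) #|Ep p|)); first by apply: leq_sum => p; exact: Epl.
  apply: sum_card_overlap => [p pQ|e].
    by apply: (@finset.bigcup_sup _ _ p).
  rewrite -(eqP (valP (tnth w e))); apply: subset_leq_card.
  apply/fintype.subsetP => p; rewrite inE => /andP[_ /Epw[q [_ ->]]].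
  by rewrite !inE eqxx orbT.
have sub : Q :|: Q' \subset T by rewrite finset.subUset !roots_sub.
have eQ := leq_trans (subset_leq_card EQ) (sparse _ sub).
have := finset.cardsU Q Q'; have tQ : t <= #|Q| * t by rewrite leq_pmull.
by rewrite mulnBr leq_subLR -doubleMr mulnS; lia.
Qed.

(** Each bin of [high] at level l+1 was raised from load l by an item whose two bins are roots of
    depth h. An insertion raises a single bin, so these items are distinct. They are inside the set
    P of roots, and |P| + t <= (t+1) |P| for P nonempty. *)
Lemma high_roots n m h (w : m.-tuple (bin_pair n)) a (T : {set 'I_n}) t l l0 :
  history h w a -> l0 <= l ->
  (forall (i : 'I_m) X Y, val (tnth w i) = [set X; Y] -> X \in T ->
     l0 <= load (a m) Y -> Y \in T) ->
  (forall Q : {set 'I_n}, Q \subset T -> #|inside w Q| <= #|Q| + t) ->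
  #|high (a m) T l.+1| <= t.+1 * #|roots m a T l h|.
Proof.
move=> ha l0l clos sparse; set N := high _ _ _; set P := roots _ _ _ _ _.
have items (i : 'I_m) := history_items ha (ltnW (ltn_ord i)).
have mono (i : 'I_m) X : load (a i) X <= load (a m) X.
  by apply: history_load ha _ _ _ _ _ => //; exact: ltnW.
(* Loads at time [i] bound the final loads from below, so closure of [T] applies at each step of a
   walk through loaded bins. *)
have closT (i : 'I_m) X s Y : trail (a i) X s Y ->
    (forall s1 Z, size s1 <= size s -> trail (a i) X s1 Z -> l <= load (a i) Z) ->
    (X \in T) = (Y \in T).
  elim=> // X' Y' Z' e s' oe tr IH all.
  have eM : e < m.
    have := trail_lt (trail_cons oe tr) (mem_head _ _).
    by rewrite (items i).1 => /ltn_trans; apply.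
  have we := (items i).2 (Ordinal eM) _ _ oe.
  have lX : l <= load (a i) X' by apply: (all [::]) => //; constructor.
  have lY : l <= load (a i) Y'.
    by apply: (all [:: e]) => //; econstructor; [exact: oe|constructor].
  rewrite -IH; last by move=> s1 Z s1s t1; apply: (all (e :: s1)) => //; econstructor; eauto.
  apply/idP/idP => inT.
    apply: (clos (Ordinal eM) X' Y' _ inT); first by rewrite finset.setUC.
    exact: leq_trans (leq_trans l0l lY) _.
  by apply: (clos (Ordinal eM) Y' X' _ inT); [|exact: leq_trans (leq_trans l0l lX) _].
pose raises (i : 'I_m) Y := [/\ val (tnth w i) \subset P
  & forall Z, load (a i.+1) Z = load (a i) Z + (Y == Z)].
have raiseN Y : Y \in N -> exists i, raises i Y.
  rewrite inE => /andP[YT lY].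
  have [i [U Ui [[s sh tr] vis ld]]] := history_raise ha lY; exists i; split=> //.
  (* The search path links [U] to [Y], which is in [T]; the item then brings its other bin into
     [T]. *)
  have UT : U \in T.
    rewrite (closT i U s Y tr) // => s1 Z s1s t1; apply: (vis U) => //.
    by exists s1 => //; exact: leq_trans sh.
  have sT : val (tnth w i) \subset T.
    apply/fintype.subsetP => V Vi; have [->//|VU] := eqVneq V U.
    apply: (clos i U V _ UT); last first.
      by rewrite (leq_trans l0l) // (leq_trans _ (mono i V)) // (vis V) //; exact: visited0.
    apply/eqP; rewrite eq_sym eqEcard finset.subUset !finset.sub1set Ui Vi /=.
    by rewrite (eqP (valP (tnth w i))) cards2 eq_sym VU.
  apply/fintype.subsetP => V Vi; rewrite inE; apply/existsP; exists i; apply/asboolP.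
  move=> Z [s' s'h tr']; split; first by apply: (vis V) => //; exists s'.
  rewrite -(closT i V s' Z tr'); first exact: (fintype.subsetP sT).
  by move=> s1 Z1 s1s t1; apply: (vis V) => //; exists s1 => //; exact: leq_trans s'h.
have [->|[Y0 Y0N]] := set_0Vmem N; first by rewrite cards0.
have [i0 [i0P _]] := raiseN _ Y0N.
have P0 : 0 < #|P|.
  by apply: leq_trans (subset_leq_card i0P); rewrite (eqP (valP (tnth w i0))).
pose f Y := odflt i0 [pick i | `[< raises i Y >]].
have fP Y : Y \in N -> raises (f Y) Y.
  by move=> /raiseN[i ri]; rewrite /f; case: pickP => [? /asboolP//|/(_ i)/asboolP].
have : #|N| <= #|inside w P|.
  rewrite -(card_in_imset (f := f)); last first.
    move=> Y Y' /fP[_ ld] /fP[_ ld'] eqf; have := ld Y; rewrite eqf ld' eqxx.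
    by case: eqVneq => // _; lia.
  apply: subset_leq_card; apply/fintype.subsetP => _ /imsetP[Y /fP[sP _] ->].
  by rewrite inE.
move=> /leq_trans/(_ (sparse _ (roots_sub _ _ _ _ _))) NP.
by apply: leq_trans NP _; rewrite mulSn leq_add2l leq_pmulr.
Qed.

(** Roots of depth 0 have final load at least l, and h uses of [roots_grow] descend to them from
    depth h. The factor t+1 from [high_roots] is absorbed in (t+1)^h. *)
Lemma high_grow n m h (w : m.-tuple (bin_pair n)) a (T : {set 'I_n}) t l l0 :
  0 < h -> history h w a -> l0 <= l ->
  (forall (i : 'I_m) X Y, val (tnth w i) = [set X; Y] -> X \in T ->
     l0 <= load (a m) Y -> Y \in T) ->
  (forall Q : {set 'I_n}, Q \subset T -> #|inside w Q| <= #|Q| + t) ->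
  #|high (a m) T l.+1| * (l - t.+1.*2) ^ h <= #|high (a m) T l| * t.+1.*2 ^ h.
Proof.
move=> h0 ha l0l clos sparse.
have rootsj j : #|roots m a T l j| * (l - t.+1.*2) ^ j <= 2 ^ j * #|high (a m) T l|.
  elim: j => [|j IH].
    rewrite muln1 mul1n; apply: subset_leq_card; apply/fintype.subsetP => p.
    rewrite !inE => /existsP[i /asboolP/(_ p (visited0 _ _ _))[lp ->]] /=.
    by apply: leq_trans lp _; apply: history_load ha _ _ _ _ _ => //; exact: ltnW.
  have := roots_grow l j ha sparse.
  rewrite !expnS mulnA => gr; apply: leq_trans (leq_mul gr (leqnn _)) _.
  by rewrite -mul2n -!mulnA leq_mul2l IH orbT.
have tT : t.+1 <= t.+1 ^ h by rewrite -{1}(expn1 t.+1) leq_pexp2l.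
apply: leq_trans (leq_mul (high_roots ha l0l clos sparse) (leqnn _)) _.
rewrite -mulnA; apply: leq_trans (leq_mul tT (rootsj h)) _.
by rewrite -(muln2 t.+1) expnMn mulnA mulnC.
Qed.

(** * Clusters of highly loaded bins *)

Definition touching n m (w : m.-tuple (bin_pair n)) (Q : {set 'I_n}) : {set 'I_m} :=
  [set i | ~~ [disjoint val (tnth w i) & Q]].

(** An item is stored in one bin only, so the loads in [Q] count distinct items. *)
Lemma touching_load n m h (w : m.-tuple (bin_pair n)) a (Q : {set 'I_n}) l :
  history h w a -> {in Q, forall X, l <= load (a m) X} ->
  #|Q| * l <= #|touching w Q|.
Proof.
move=> ha lQ; have [sm items] := history_items ha (leqnn m).
rewrite -[#|touching w Q|]muln1 -sum_nat_const.
apply: (@leq_trans (\sum_(X in Q) load (a m) X)); first by apply: leq_sum => X; exact: lQ.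
under eq_bigr => X _ do rewrite (@loadE n m) ?sm //.
apply: sum_card_overlap => [X XQ|e].
  apply/fintype.subsetP => e; rewrite !inE; case oe: (onth _ _) => [[Y X']|] // /eqP /= XX'.
  by apply/pred0Pn; exists X; rewrite /= (items _ _ _ oe) XX' !inE eqxx orbT.
case oe: (onth (a m) e) => [[Y X]|]; last first.
  by rewrite eq_card0 // => Z; rewrite !inE oe andbF.
rewrite -(cards1 X); apply: subset_leq_card; apply/fintype.subsetP => Z.
by rewrite !inE oe /= => /andP[_]; rewrite eq_sym.
Qed.

(* The cluster is a maximal set [T] of highly loaded bins containing [X] with at
   least [#|T| - 1] items inside; maximality makes it closed under adjacency, so
   it replaces a connected component. *)
Lemma overload_bound n m h (w : m.-tuple (bin_pair n)) a t l0 k b d X :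
  0 < h -> 0 < k -> history h w a ->
  (forall Q : {set 'I_n}, #|Q| <= k -> #|inside w Q| <= #|Q| + t) ->
  (forall Q : {set 'I_n}, #|Q| = k -> #|Q| <= #|inside w Q|.+1 -> #|touching w Q| < k * l0) ->
  l0 + t.+1.*2 * b.+1 + d <= load (a m) X ->
  b ^ (h * d) < k.
Proof.
move=> h0 k0 ha sparse thin lX.
pose P (Q : {set 'I_n}) := [&& X \in Q, #|Q| <= k, #|Q| <= #|inside w Q|.+1 &
  Q \subset [set Y | l0 <= load (a m) Y]].
have P1 : P [set X].
  rewrite /P inE eqxx cards1 k0 /= finset.sub1set inE.
  by apply: leq_trans lX; rewrite -addnA leq_addr.
case: (arg_maxnP (fun Q : {set 'I_n} => #|Q|) P1) => T /and4P[XT Tk Tin /fintype.subsetP TS] maxT.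
(* With exactly k bins of load at least [l0], at least k [l0] items would touch [T], against
   [thin]. *)
have {}Tk : #|T| < k.
  rewrite ltn_neqAle Tk andbT; apply/negP => /eqP Tk'.
  have := thin T Tk' Tin; rewrite ltnNge -Tk' (touching_load ha) // => Y.
  by move=> /TS; rewrite inE.
(* Otherwise [Z] could be added to [T]: item [i] is inside the larger set but not inside [T], which
   pays for the new bin. *)
have clos (i : 'I_m) Y Z : val (tnth w i) = [set Y; Z] -> Y \in T ->
    l0 <= load (a m) Z -> Z \in T.
  move=> wi YT lZ; apply: contraT => ZT.
  suff /maxT : P (Z |: T) by rewrite /= cardsU1 ZT add1n ltnn.
  rewrite /P inE XT orbT cardsU1 ZT add1n Tk /= finset.subUset finset.sub1set inE lZ /=.
  apply/andP; split; last by apply/fintype.subsetP.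
  apply: leq_trans (_ : (#|i |: inside w T|).+1 <= _); last first.
    apply: subset_leq_card; apply/fintype.subsetP => j; rewrite !inE => /orP[/eqP ->|jT].
      by rewrite wi finset.subUset !finset.sub1set !inE YT eqxx orbT.
    exact: fintype.subset_trans jT (finset.subsetUr _ _).
  rewrite cardsU1; suff -> : i \notin inside w T by [].
  by rewrite inE wi finset.subUset !finset.sub1set YT ZT.
have sparseT (Q : {set 'I_n}) : Q \subset T -> #|inside w Q| <= #|Q| + t.
  by move=> /subset_leq_card QT; apply: sparse; apply: leq_trans (ltnW Tk).
set l1 := l0 + _ in lX.
(* Each level down multiplies the number of bins by b^h: from [l1] upwards, l - M >= b M with M =
   2(t+1). *)
suff low d' : d' <= d -> b ^ (h * d') <= #|high (a m) T (l1 + (d - d'))|.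
  apply: leq_trans (Tk); rewrite ltnS; apply: leq_trans (low d (leqnn d)) _.
  by apply: subset_leq_card; apply/fintype.subsetP => Y; rewrite inE => /andP[].
elim: d' => [|d' IH] dd.
  by rewrite muln0 card_gt0; apply/set0Pn; exists X; rewrite inE XT subn0.
have := IH (ltnW dd); have -> : d - d' = (d - d'.+1).+1 by rewrite subnSK.
set l := l1 + (d - d'.+1); rewrite addnS -/l => IHl.
have l0l : l0 <= l by rewrite /l /l1 -!addnA leq_addr.
have := high_grow h0 ha l0l clos sparseT; set M := t.+1.*2 => gr.
have Mh : 0 < M ^ h by rewrite expn_gt0.
rewrite -(leq_pmul2r Mh); apply: leq_trans gr.
rewrite mulnS expnD [b ^ h * _]mulnC -mulnA -expnMn; apply: leq_mul => //.
rewrite leq_exp2r // leq_subRL; last by rewrite /l /l1 mulnS; lia.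
by rewrite /l /l1 mulnS [b * M]mulnC; lia.
Qed.

(** * Probabilistic estimates *)

Local Open Scope ring_scope.

Lemma card_pairs_inside n (Q : {set 'I_n}) :
  #|[pred e : bin_pair n | val e \subset Q]| = 'C(#|Q|, 2).
Proof.
rewrite -cards_draws -(card_imset _ val_inj); apply: eq_card => A.
rewrite inE; apply/imsetP/andP => [[e eQ ->]|[AQ A2]].
  by split; [exact: eQ|exact: (valP e)].
by exists (Sub A A2).
Qed.

Lemma card_bin_pair n : #|{: bin_pair n}| = 'C(n, 2).
Proof.
rewrite -[in RHS](card_ord n) -[in RHS]finset.cardsT -card_pairs_inside.
by apply: eq_card => e; rewrite !inE finset.subsetT.
Qed.

Lemma card_pairs_touching n (Q : {set 'I_n}) :
  (#|[pred e : bin_pair n | ~~ [disjoint val e & Q]]| + 'C(n - #|Q|, 2) = 'C(n, 2))%N.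
Proof.
have -> : (n - #|Q|)%N = #|~: Q| by rewrite (cardsCs (~: Q)) finset.setCK card_ord.
rewrite -card_pairs_inside -card_bin_pair addnC.
rewrite -(cardC [pred e : bin_pair n | val e \subset ~: Q]).
by congr addn; apply: eq_card => e; rewrite !inE -finset.disjoints_subset.
Qed.

Lemma prob_union (R : realType) (T S : finType) (A : pred S) (E : S -> pred T) :
  Prob R (fun w => [exists x in A, E x w]) <= \sum_(x in A) Prob R (E x).
Proof.
rewrite /Prob -mulr_suml ler_wpM2r ?invr_ge0 ?ler0n // -natr_sum ler_nat.
rewrite -!sum1_card.
under [X in (_ <= X)%N]eq_bigr => x _ do rewrite -sum1_card big_mkcond /=.
rewrite big_mkcond exchange_big; apply: leq_sum => w _.
case: ifP => // /existsP[x /andP[xA xw]].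
by rewrite (bigD1 x) //= [w \in _]xw.
Qed.

Lemma prob_le (R : realType) (T : finType) (E E' : pred T) :
  (forall w, E w -> E' w) -> Prob R E <= Prob R E'.
Proof.
move=> EE'; rewrite /Prob ler_wpM2r ?invr_ge0 ?ler0n // ler_nat.
by apply: subset_leq_card; apply/fintype.subsetP => w; exact: EE'.
Qed.

Lemma prob_tuple (R : realType) (T : finType) m (B : 'I_m -> pred T) :
  Prob R (fun w : m.-tuple T => [forall i, B i (tnth w i)]) = \prod_i Prob R (B i).
Proof.
rewrite /Prob big_split /= -natr_prod prodfV prodr_const card_tuple card_ord natrX.
congr (_%:R / _); transitivity #|family (fun i => B i)|; last first.
  by rewrite card_family foldrE big_image.
pose f (w : m.-tuple T) := [ffun i => tnth w i].
have finj : injective f.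
  by move=> w w' /ffunP eqf; apply: eq_from_tnth => i; have := eqf i; rewrite !ffunE.
rewrite -(fintype.card_image finj); apply: eq_card => g.
apply/fintype.imageP/familyP => [[w Bw ->] i|Bg].
  by rewrite ffunE; exact: (forallP Bw i).
exists [tuple g i | i < m]; last by apply/ffunP => i; rewrite ffunE tnth_mktuple.
by apply/forallP => i; rewrite tnth_mktuple; exact: Bg.
Qed.

Lemma prob_tuple2 (R : realType) (T : finType) m (F J : {set 'I_m}) (B B' : pred T) :
  (0 < #|T|)%N -> [disjoint F & J] ->
  Prob R (fun w : m.-tuple T => [forall i in F, B (tnth w i)] &&
                                [forall i in J, B' (tnth w i)])
  = Prob R B ^+ #|F| * Prob R B' ^+ #|J|.
Proof.
move=> T0 FJ.
pose C i : pred T := if i \in F then B else if i \in J then B' else predT.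
transitivity (Prob R (fun w : m.-tuple T => [forall i, C i (tnth w i)])).
  congr (_%:R / _); apply: eq_card => w; rewrite !unfold_in.
  apply/andP/forallP => [[/forall_inP FB /forall_inP JB] i|CC].
    by rewrite /C; case: ifP => [/FB//|_]; case: ifP => [/JB|].
  split; apply/forall_inP => i iF; have := CC i; rewrite /C; first by rewrite iF.
  by rewrite iF (disjointFl FJ iF).
rewrite prob_tuple (bigID (mem F)) /=; congr (_ * _).
  by rewrite -prodr_const; apply: eq_bigr => i iF; rewrite /C iF.
rewrite (bigID (mem J)) /= [X in _ * X]big1 ?mulr1; last first.
  move=> i /andP[/negPf iF /negPf iJ]; rewrite /C iF iJ /Prob divff //.
  by rewrite pnatr_eq0 -lt0n.
rewrite -prodr_const; apply: eq_big => [i|i /andP[/negPf iF iJ]]; last by rewrite /C iF iJ.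
by rewrite andb_idl // => iJ; rewrite (disjointFl FJ iJ).
Qed.

Lemma bin2M n : (2 * 'C(n, 2) = n * n.-1)%N.
Proof. by rewrite -mul_bin_diag bin1. Qed.

(** With k = |Q| the exact value is k(k-1)/(n(n-1)), and (k-1)/(n-1) <= k/n because k <= n. *)
Lemma prob_pair_inside (R : realType) n (Q : {set 'I_n}) : (1 < n)%N ->
  Prob R (fun e : bin_pair n => val e \subset Q) <= (#|Q|%:R / n%:R) ^+ 2.
Proof.
move=> n1; have n0 : 0 < n%:R :> R by rewrite ltr0n ltnW.
rewrite /Prob card_bin_pair (card_pairs_inside Q) expr_div_n.
rewrite ler_pdivrMr ?ltr0n ?bin_gt0 // mulrAC ler_pdivlMr ?exprn_gt0 //.
rewrite -!natrX -!natrM ler_nat -(leq_pmul2l (isT : 0 < 2)%N) mulnA bin2M mulnCA bin2M.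
have : (#|Q| <= n)%N by rewrite -[X in (_ <= X)%N]card_ord max_card.
move: #|Q| => k kn; case: k kn => // k kn; case: n n1 kn {n0 Q} => // n _ kn /=.
have knS : (k * n.+1 <= k.+1 * n)%N by rewrite mulnS mulSn leq_add2r.
by have := leq_mul (leqnn (k.+1 * n.+1)) knS; rewrite !expnS !expn0 !muln1; lia.
Qed.

(** With k = |Q| there are k(2n-k-1)/2 such pairs, at most k(n-1). *)
Lemma prob_pair_touching (R : realType) n (Q : {set 'I_n}) : (1 < n)%N ->
  Prob R (fun e : bin_pair n => ~~ [disjoint val e & Q]) <= 2 * #|Q|%:R / n%:R.
Proof.
move=> n1; have n0 : 0 < n%:R :> R by rewrite ltr0n ltnW.
rewrite /Prob card_bin_pair.
rewrite ler_pdivrMr ?ltr0n ?bin_gt0 // mulrAC ler_pdivlMr //.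
rewrite -!natrM ler_nat -(leq_pmul2l (isT : 0 < 2)%N).
have : (#|(fun e : bin_pair n => ~~ [disjoint val e & Q])| + 'C(n - #|Q|, 2) = 'C(n, 2))%N.
  exact: card_pairs_touching.
have : (#|Q| <= n)%N by rewrite -[X in (_ <= X)%N]card_ord max_card.
have := bin2M n; have := bin2M (n - #|Q|).
move: #|(fun e : bin_pair n => ~~ [disjoint val e & Q])| => t.
move: #|Q| 'C(n - _, 2) 'C(n, 2) => k u v uE vE kn tE.
have [d nE] : exists d, n = (k + d)%N by exists (n - k)%N; lia.
case: n n1 n0 kn uE vE tE nE {Q} => // n n1 _ kn; rewrite /= => uE vE tE nE.
have [d0|d0] := eqVneq d 0%N.
  have kE : k = n.+1 by lia.
  by move: uE; rewrite kE subnn; nia.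
have k1 : (k <= n)%N by lia.
move: uE; rewrite subSn //= => uE.
have [e eE] : exists e, n = (k + e)%N by exists (n - k)%N; lia.
move: vE uE; rewrite eE addKn => vE uE.
have t2 : (2 * t <= 2 * k * (k + e))%N.
  have tE2 : (2 * t = k * (k + 2 * e + 1))%N by nia.
  by rewrite tE2; case: (k) => // k'; nia.
have := leq_mul t2 (leqnn (k + e).+1).
have -> : (2 * (2 * k * v) = 2 * k * (2 * v))%N by lia.
by rewrite vE; lia.
Qed.

(** Union bound over triples (Q, F, J), where F consists of f items inside Q and J of j other items
    touching Q. Disjointness of F and J lets independence multiply the probabilities; binomials are
    bounded by powers over factorials. *)
Lemma prob_subgraph (R : realType) n m sigma k f j :
  (1 < n)%N -> (m <= sigma * n)%N ->
  Prob R (fun w : m.-tuple (bin_pair n) => [exists Q : {set 'I_n},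
    [&& #|Q| == k, (f <= #|inside w Q|)%N & (f + j <= #|touching w Q|)%N]])
  <= n%:R ^+ k / k`!%:R * ((sigma * k ^ 2)%:R / n%:R) ^+ f / f`!%:R
     * (2 * sigma * k)%:R ^+ j / j`!%:R.
Proof.
move=> n1 mn; have n0 : 0 < n%:R :> R by rewrite ltr0n ltnW.
pose S := ({set 'I_n} * {set 'I_m} * {set 'I_m})%type.
pose A : pred S := fun x =>
  [&& #|x.1.1| == k, #|x.1.2| == f, #|x.2| == j & [disjoint x.1.2 & x.2]].
pose E (x : S) : pred (m.-tuple (bin_pair n)) := fun w =>
  [forall i in x.1.2, val (tnth w i) \subset x.1.1] &&
  [forall i in x.2, ~~ [disjoint val (tnth w i) & x.1.1]].
apply: (@le_trans _ _ (Prob R (fun w => [exists x in A, E x w]))).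
  apply: prob_le => w /existsP[Q /and3P[Qk fQ fjQ]].
  have [F [FQ Ff]] : exists F : {set 'I_m}, F \subset inside w Q /\ #|F| = f.
    have : (0 < #|[set F : {set 'I_m} | (F \subset inside w Q) & (#|F| == f)]|)%N.
      by rewrite cards_draws bin_gt0.
    by move=> /card_gt0P[F]; rewrite inE => /andP[? /eqP]; exists F.
  (* Removing [F] costs at most f of the f + j touching items. *)
  have [J [JQ Jj]] : exists J : {set 'I_m}, J \subset touching w Q :\: F /\ #|J| = j.
    have : (0 < #|[set J : {set 'I_m} | (J \subset touching w Q :\: F) & (#|J| == j)]|)%N.
      rewrite cards_draws bin_gt0 cardsD.
      have : (#|touching w Q :&: F| <= f)%N by rewrite -Ff subset_leq_card // finset.subsetIr.
      by move: fjQ; lia.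
    by move=> /card_gt0P[J]; rewrite inE => /andP[? /eqP]; exists J.
  apply/existsP; exists (Q, F, J); rewrite /A /E unfold_in /= Qk Ff Jj !eqxx /=.
  move: JQ; rewrite finset.subsetD => /andP[JQ]; rewrite disjoint_sym => -> /=.
  apply/andP; split; apply/forall_inP => i.
    by move=> /(fintype.subsetP FQ); rewrite inE.
  by move=> /(fintype.subsetP JQ); rewrite inE.
apply: le_trans (prob_union _ _ _) _.
pose q : R := ((k%:R / n%:R) ^+ 2) ^+ f * (2 * k%:R / n%:R) ^+ j.
apply: (@le_trans _ _ (\sum_(x in A) q)).
  apply: ler_sum => -[[Q F] J]; rewrite unfold_in /A /= => /and4P[/eqP Qk /eqP Ff /eqP Jj FJ].
  have -> : Prob R (E (Q, F, J)) = Prob R (fun e : bin_pair n => val e \subset Q) ^+ #|F| *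
      Prob R (fun e : bin_pair n => ~~ [disjoint val e & Q]) ^+ #|J|.
    by apply: prob_tuple2; rewrite ?card_bin_pair ?bin_gt0.
  rewrite /q -Qk -Ff -Jj; apply: ler_pM; rewrite ?exprn_ge0 ?divr_ge0 ?ler0n //.
    by apply: lerXn2r; rewrite ?nnegrE ?divr_ge0 ?exprn_ge0 ?divr_ge0 ?ler0n ?prob_pair_inside.
  by apply: lerXn2r; rewrite ?nnegrE ?divr_ge0 ?mulr_ge0 ?ler0n ?prob_pair_touching.
rewrite sumr_const -(mulr_natl q).
have cardA : (#|A| <= 'C(n, k) * 'C(m, f) * 'C(m, j))%N.
  rewrite -[n in 'C(n, k)]card_ord -[m in 'C(m, f)]card_ord -[m in 'C(m, j)]card_ord.
  rewrite -!card_draws -!cardsX; apply: subset_leq_card; apply/fintype.subsetP => -[[Q F] J].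
  by rewrite unfold_in /A /= !inE /= => /and4P[-> -> ->].
have binR p r : 'C(p, r)%:R <= p%:R ^+ r / r`!%:R :> R.
  rewrite ler_pdivlMr ?ltr0n ?fact_gt0 // -natrX -natrM ler_nat bin_ffact.
  by elim: r => // r IH; rewrite ffactnSr expnSr leq_mul ?leq_subr.
have m_le r : m%:R ^+ r / r`!%:R <= (sigma%:R * n%:R) ^+ r / r`!%:R :> R.
  rewrite ler_wpM2r ?invr_ge0 ?ler0n //; apply: lerXn2r.
  - by rewrite nnegrE ler0n.
  - by rewrite nnegrE mulr_ge0.
  - by rewrite -natrM ler_nat.
have q0 : 0 <= q.
  by rewrite /q; apply: mulr_ge0; apply: exprn_ge0; rewrite ?sqr_ge0 // divr_ge0 ?mulr_ge0.
apply: (@le_trans _ _ ('C(n, k)%:R * 'C(m, f)%:R * 'C(m, j)%:R * q)).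
  by rewrite ler_wpM2r // -!natrM ler_nat.
apply: (@le_trans _ _ (n%:R ^+ k / k`!%:R * ((sigma%:R * n%:R) ^+ f / f`!%:R) *
    ((sigma%:R * n%:R) ^+ j / j`!%:R) * q)).
  rewrite ler_wpM2r //; apply: ler_pM; rewrite ?mulr_ge0 ?ler0n //;
    last exact: le_trans (binR _ _) _.
  by apply: ler_pM; rewrite ?ler0n //; exact: le_trans (binR _ _) _.
have -> : (sigma * k ^ 2)%:R / n%:R = (sigma%:R * n%:R) * (k%:R / n%:R) ^+ 2 :> R.
  by rewrite natrM natrX; field; rewrite gt_eqF.
have -> : (2 * sigma * k)%:R = (sigma%:R * n%:R) * (2 * k%:R / n%:R) :> R.
  by rewrite !natrM; field; rewrite gt_eqF.
rewrite /q [(_ * _ ^+ 2) ^+ f]exprMn [(_ * (2 * _ / _)) ^+ j]exprMn.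
rewrite le_eqVlt; apply/orP; left; apply/eqP.
move: (_ ^+ f) (_ ^+ f) (_ ^+ j) (_ ^+ j) (_ ^+ k) => u v u' v' z.
ring.
Qed.

(** A weak Stirling bound: k^k <= (k+1)...(2k) = C(2k,k) k!, and C(2k,k) <= 4^k. *)
Lemma expn_self_le_fact k : (k ^ k <= 4 ^ k * k`!)%N.
Proof.
have bin2X p r : ('C(p, r) <= 2 ^ p)%N.
  elim: p r => [|p IH] [|r]; rewrite ?bin0 ?bin0n ?expn_gt0 //.
  by rewrite binS expnS mul2n -addnn leq_add.
have ffactX r : (k ^ r <= (k + r) ^_ r)%N.
  elim: r => // r IH; rewrite addnS ffactSS expnS leq_mul //.
  by rewrite -addnS leq_addr.
apply: leq_trans (ffactX k) _.
by rewrite -bin_ffact addnn -[4%N]/(2 ^ 2)%N -expnM mul2n leq_mul2r bin2X orbT.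
Qed.

Lemma factD_ge k t : (k`! * k ^ t <= (k + t)`!)%N.
Proof.
elim: t => [|t IH]; first by rewrite muln1 addn0.
by rewrite addnS factS expnSr mulnA mulnC leq_mul // -addnS leq_addr.
Qed.

(** The bound of [prob_subgraph] for f = k + t and j = 0. Powers of n cancel down to n^-t, and k!
    (k+t)! >= k!^2 k^t absorbs k^(2k+t) at the price of 16^k. *)
Lemma excess_bound (R : realType) n sigma k t : (0 < n)%N ->
  n%:R ^+ k / k`!%:R * ((sigma * k ^ 2)%:R / n%:R) ^+ (k + t) / (k + t)`!%:R
  <= (16 * sigma)%:R ^+ k * ((sigma * k)%:R / n%:R) ^+ t :> R.
Proof.
move=> n0; have nR : n%:R != 0 :> R by rewrite pnatr_eq0 -lt0n.
have kf : 0 < k`!%:R :> R by rewrite ltr0n fact_gt0.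
rewrite ler_pdivrMr ?ltr0n ?fact_gt0 //.
have -> : n%:R ^+ k / k`!%:R * ((sigma * k ^ 2)%:R / n%:R) ^+ (k + t) =
  (sigma ^ k * k ^ k * k ^ k * k ^ t)%:R / k`!%:R * ((sigma * k)%:R / n%:R) ^+ t :> R.
  rewrite exprD !expr_div_n !natrM !natrX !exprMn.
  have : n%:R ^+ k != 0 :> R by rewrite expf_neq0.
  have : n%:R ^+ t != 0 :> R by rewrite expf_neq0.
  move: (n%:R ^+ k) (n%:R ^+ t) (k%:R ^+ k) (k%:R ^+ t) (sigma%:R ^+ k) (sigma%:R ^+ t).
  by move=> a b c d e f b0 a0; field; rewrite a0 b0 gt_eqF.
rewrite [leRHS]mulrAC ler_wpM2r ?exprn_ge0 ?divr_ge0 //.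
rewrite ler_pdivrMr // -natrX -!natrM ler_nat.
have := factD_ge k t; have := leq_mul (expn_self_le_fact k) (expn_self_le_fact k).
rewrite expnMn -[16%N]/(4 * 4)%N expnMn => h1 h2.
have := leq_mul (leqnn (sigma ^ k)) (leq_mul h1 (leqnn (k ^ t))).
have := leq_mul (leqnn (sigma ^ k * 4 ^ k * 4 ^ k * k`!)) h2.
by rewrite !mulnA => g1 g2; apply: leq_trans g2 _; lia.
Qed.

(** The bound of [prob_subgraph] for k = p+1, f = k-1, j = D k. One factor n survives, and the
    touching items gain 2^-(Dk), since (16 sigma k)^(Dk) <= (Dk)^(Dk) <= 4^(Dk) (Dk)!. *)
Lemma dense_bound (R : realType) n sigma D p :
  (0 < n)%N -> (16 * sigma <= D)%N -> (0 < sigma)%N ->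
  n%:R ^+ p.+1 / p.+1`!%:R * ((sigma * p.+1 ^ 2)%:R / n%:R) ^+ p / p`!%:R
    * (2 * sigma * p.+1)%:R ^+ (D * p.+1) / (D * p.+1)`!%:R
  <= n%:R * ((16 * sigma)%:R / 2 ^+ D) ^+ p.+1 :> R.
Proof.
move=> n0 sD s0; have nR : n%:R != 0 :> R by rewrite pnatr_eq0 -lt0n.
have D0 : (0 < D)%N by lia.
set k := p.+1.
have A : n%:R ^+ k / k`!%:R * ((sigma * k ^ 2)%:R / n%:R) ^+ p / p`!%:R <=
    n%:R * (16 * sigma)%:R ^+ k :> R.
  rewrite ler_pdivrMr ?ltr0n ?fact_gt0 // mulrAC ler_pdivrMr ?ltr0n ?fact_gt0 //.
  have -> : n%:R ^+ k * ((sigma * k ^ 2)%:R / n%:R) ^+ p =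
      n%:R * (sigma * k ^ 2)%:R ^+ p :> R.
    rewrite exprS expr_div_n; have : n%:R ^+ p != 0 :> R by rewrite expf_neq0.
    by move: (_ ^+ p) (_ ^+ p) => a b b0; field.
  rewrite -!mulrA ler_wpM2l // -!natrX -!natrM ler_nat.
  have h1 := leq_mul (expn_self_le_fact k) (expn_self_le_fact k).
  rewrite -(leq_pmul2r (ltn0Sn p)) -/k.
    have -> : ((16 * sigma) ^ k * (p`! * k`!) * k = sigma ^ k * (4 ^ k * k`! * (4 ^ k * k`!)))%N.
        by rewrite [in LHS]expnMn -[16%N]/(4 * 4)%N expnMn [in RHS]/k factS -/k; lia.
    apply: leq_trans (leq_mul (leqnn _) h1).
  rewrite expnMn -mulnA -expnM -expnD -expnSr.
  by apply: leq_mul; rewrite leq_pexp2l // /k; lia.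
have B : (2 * sigma * k)%:R ^+ (D * k) / (D * k)`!%:R <= (2 ^+ D)^-1 ^+ k :> R.
  rewrite ler_pdivrMr ?ltr0n ?fact_gt0 // exprVn -exprM -[2]/(2%:R) mulrC.
  rewrite ler_pdivlMr ?exprn_gt0 ?ltr0n // -!natrX -natrM ler_nat.
  rewrite -(leq_pmul2l (_ : 0 < 4 ^ (D * k))%N) ?expn_gt0 //.
  apply: leq_trans (expn_self_le_fact (D * k)).
  rewrite -!expnMn leq_exp2r ?muln_gt0 ?D0 //.
  by have := leq_mul sD (leqnn k); lia.
rewrite [(_ / 2 ^+ D) ^+ k]exprMn -[leLHS]mulrA [leRHS]mulrA; apply: ler_pM A B.
- by rewrite !mulr_ge0 ?exprn_ge0 ?invr_ge0 ?mulr_ge0 ?invr_ge0.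
- by rewrite !mulr_ge0 ?exprn_ge0 ?invr_ge0.
Qed.

Lemma prob_compl (R : realType) (T : finType) (E : pred T) : (0 < #|T|)%N ->
  1 - Prob R (fun w => ~~ E w) = Prob R E.
Proof.
move=> T0; have T1 : #|T|%:R != 0 :> R by rewrite pnatr_eq0 -lt0n.
apply/eqP; rewrite subr_eq; apply/eqP; rewrite /Prob -mulrDl -natrD.
have -> : #|(fun w => ~~ E w)| = #|predC E| by apply: eq_card.
by rewrite cardC divff.
Qed.

Lemma prob_or (R : realType) (T : finType) (E E' : pred T) :
  Prob R (fun w => E w || E' w) <= Prob R E + Prob R E'.
Proof.
rewrite /Prob -mulrDl ler_wpM2r ?invr_ge0 ?ler0n // -natrD ler_nat.
by rewrite -(cardUI E E') (leq_trans _ (leq_addr _ _)) // subset_leq_card.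
Qed.

(** * Two properties that hold with high probability *)

Definition sparse_upto n m (w : m.-tuple (bin_pair n)) k t :=
  [forall Q : {set 'I_n}, (#|Q| <= k)%N ==> (#|inside w Q| <= #|Q| + t)%N].

(** The condition on [inside] is what is kept of connectivity: k connected bins have at least k-1
    items inside. *)
Definition thin_at n m (w : m.-tuple (bin_pair n)) k l :=
  [forall Q : {set 'I_n}, (#|Q| == k) ==> (#|Q| <= #|inside w Q|.+1)%N ==>
     (#|touching w Q| < k * l)%N].

Lemma sqr_le_expn2 k : (k ^ 2 <= 2 * 2 ^ k)%N.
Proof.
case: k => [|[|[|]]] // k; elim: k => // k IH.
by rewrite [in leqRHS]expnS; move: IH; rewrite !expnS !expn0; nia.
Qed.

(** With k about log n, the sum over sizes costs (k+1) (16 sigma)^k <= n^(16 sigma + 1), while the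
    excess 2r gains (sigma k / n)^(2r) = O(n^-r), as k^2 <= 2n. The choice of [r] leaves n^-q. *)
Lemma prob_not_sparse (R : realType) sigma q : (0 < sigma)%N -> exists (t : nat) (K : R),
  forall n m, (1 < n)%N -> (m <= sigma * n)%N ->
  Prob R (fun w : m.-tuple (bin_pair n) => ~~ sparse_upto w (trunc_log 2 n) t)
    <= K / n%:R ^+ q.
Proof.
move=> s0; pose al := (16 * sigma)%N; pose r := (al + 1 + q)%N.
exists (2 * r)%N, ((2 * sigma ^ 2)%:R ^+ r) => n m n1 mn.
set k := trunc_log 2 n; have n0 : (0 < n)%N by exact: ltnW.
have nR : 0 < n%:R :> R by rewrite ltr0n.
have k2n : (2 ^ k <= n)%N by apply: trunc_logP.
pose E (i : 'I_k.+1) : pred (m.-tuple (bin_pair n)) := fun w => [exists Q : {set 'I_n},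
    [&& #|Q| == i, (i + 2 * r <= #|inside w Q|)%N & (i + 2 * r + 0 <= #|touching w Q|)%N]].
apply: (@le_trans _ _ (Prob R (fun w => [exists i in predT, E i w]))).
  apply: prob_le => w; rewrite negb_forall => /existsP[Q].
  rewrite negb_imply -ltnNge => /andP[Qk Qin].
  apply/existsP; exists (Ordinal (Qk : #|Q| < k.+1)%N); rewrite /E /=.
  apply/existsP; exists Q; rewrite eqxx addn0 ltnW //=.
  apply: leq_trans (ltnW Qin) _; apply: subset_leq_card; apply/fintype.subsetP => i.
  rewrite !inE => iQ; rewrite -finset.setI_eq0 (finset.setIidPl iQ) -cards_eq0.
  by rewrite (eqP (valP (tnth w i))).
apply: le_trans (prob_union _ _ _) _.
apply: (@le_trans _ _
  (\sum_(i in {: 'I_k.+1}) al%:R ^+ k * ((sigma * k)%:R / n%:R) ^+ (2 * r))).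
  apply: ler_sum => i _; apply: le_trans (prob_subgraph _ _ _ _ n1 mn) _.
  rewrite expr0 mulr1 fact0 divr1; apply: le_trans (excess_bound _ _ _ _ n0) _.
  have ik : (i <= k)%N by rewrite -ltnS.
  apply: ler_pM; rewrite ?exprn_ge0 ?divr_ge0 //.
    by rewrite -!natrX ler_nat leq_pexp2l // muln_gt0.
  apply: lerXn2r; rewrite ?nnegrE ?divr_ge0 //.
  by rewrite ler_wpM2r ?invr_ge0 // ler_nat leq_mul.
rewrite sumr_const card_ord -(mulr_natl (_ * _)) mulrA.
have A : k.+1%:R * al%:R ^+ k <= n%:R ^+ (al + 1) :> R.
  rewrite -!natrX -natrM ler_nat addn1 expnS; apply: leq_mul.
    by apply: leq_trans k2n; exact: ltn_expl.
  apply: (@leq_trans ((2 ^ al) ^ k)).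
    by case: (posnP k) => [->//|k0]; rewrite leq_exp2r //; apply/ltnW/ltn_expl.
  by rewrite -expnM mulnC expnM leq_exp2r // muln_gt0.
have B : ((sigma * k)%:R / n%:R) ^+ (2 * r) <= ((2 * sigma ^ 2)%:R / n%:R) ^+ r :> R.
  rewrite exprM; apply: lerXn2r; rewrite ?nnegrE ?exprn_ge0 ?divr_ge0 //.
  rewrite expr_div_n ler_pdivrMr ?exprn_gt0 // [n%:R ^+ 2]expr2 mulrA divfK ?gt_eqF //.
  rewrite -natrX -natrM ler_nat expnMn [(2 * _)%N]mulnC -mulnA leq_mul2l.
  by rewrite (leq_trans (sqr_le_expn2 k)) ?orbT // leq_mul2l.
apply: le_trans (ler_pM _ _ A B) _; rewrite ?mulr_ge0 ?exprn_ge0 ?divr_ge0 //.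
rewrite expr_div_n mulrCA ler_wpM2l ?exprn_ge0 // /r (exprD _ (al + 1)) invfM mulrA.
by rewrite divff ?mul1r // expf_neq0 // gt_eqF.
Qed.

(** [D] is large enough for [dense_bound] and for 16 sigma / 2^D <= 2^-(q+1). This gives n
    2^-((q+1)k), and n < 2^(k+1) turns it into 2^(q+1) / n^q. *)
Lemma prob_not_thin (R : realType) sigma q : (0 < sigma)%N -> exists (l : nat) (K : R),
  forall n m, (1 < n)%N -> (m <= sigma * n)%N ->
  Prob R (fun w : m.-tuple (bin_pair n) => ~~ thin_at w (trunc_log 2 n) l)
    <= K / n%:R ^+ q.
Proof.
move=> s0; pose al := (16 * sigma)%N; pose D := (al + al + q.+1)%N.
(* Of (D+1) k touching items, at least D k remain besides k-1 inside. *)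
exists D.+1, (2 ^+ q.+1) => n m n1 mn.
set k := trunc_log 2 n; have n0 : (0 < n)%N by exact: ltnW.
have nR : 0 < n%:R :> R by rewrite ltr0n.
have n2k : (n < 2 ^ k.+1)%N by apply: trunc_log_ltn.
case: (posnP k) => [k0|k0]; first by move: n2k; rewrite k0; lia.
have kE : k = k.-1.+1 by rewrite prednK.
pose E : pred (m.-tuple (bin_pair n)) := fun w => [exists Q : {set 'I_n},
    [&& #|Q| == k, (k.-1 <= #|inside w Q|)%N & (k.-1 + D * k <= #|touching w Q|)%N]].
apply: (@le_trans _ _ (Prob R E)).
  apply: prob_le => w; rewrite negb_forall => /existsP[Q].
  rewrite !negb_imply -leqNgt => /and3P[/eqP Qk Qin Qt].
  apply/existsP; exists Q; rewrite Qk eqxx -ltnS -kE -Qk Qin /=.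
  by apply: leq_trans Qt; rewrite Qk; move: kE; nia.
apply: le_trans (prob_subgraph _ _ _ _ n1 mn) _.
have alD : (16 * sigma <= D)%N by rewrite /D -addnA leq_addr.
have := dense_bound R k.-1 n0 alD s0; rewrite -kE => /le_trans; apply.
have base : (16 * sigma)%:R / 2 ^+ D <= (2 ^+ q.+1)^-1 :> R.
  rewrite ler_pdivrMr ?exprn_gt0 // mulrC ler_pdivlMr ?exprn_gt0 //.
  rewrite -!natrX -natrM ler_nat expnD leq_mul // expnD.
  by apply: (@leq_trans (2 ^ al)); [apply/ltnW/ltn_expl|rewrite leq_pmulr ?expn_gt0].
apply: (@le_trans _ _ (n%:R * ((2 ^+ q.+1)^-1) ^+ k)).
  rewrite ler_wpM2l // lerXn2r // nnegrE ?invr_ge0 ?divr_ge0 ?exprn_ge0 //.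
rewrite exprVn -exprM mulnC exprM ler_pdivlMr ?exprn_gt0 // mulrAC -exprS.
rewrite ler_pdivrMr ?exprn_gt0 // -exprMn lerXn2r ?nnegrE ?mulr_ge0 ?exprn_ge0 //.
by rewrite -exprS -natrX ler_nat ltnW.
Qed.

Lemma prob_sparse_thin (R : realType) sigma q : (0 < sigma)%N ->
  exists (t l : nat) (K : R), forall n m, (1 < n)%N -> (m <= sigma * n)%N ->
  1 - K / n%:R ^+ q <= Prob R (fun w : m.-tuple (bin_pair n) =>
    sparse_upto w (trunc_log 2 n) t && thin_at w (trunc_log 2 n) l).
Proof.
move=> s0; have [t [K1 H1]] := prob_not_sparse R q s0.
have [l [K2 H2]] := prob_not_thin R q s0.
exists t, l, (K1 + K2) => n m n1 mn.
rewrite -prob_compl; last by rewrite card_tuple expn_gt0 card_bin_pair bin_gt0 n1.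
rewrite lerD2l lerN2 mulrDl; apply: le_trans (lerD (H1 n m n1 mn) (H2 n m n1 mn)).
by apply: le_trans (prob_or _ _ _); apply: prob_le => w; rewrite negb_and.
Qed.

(** * The choice of the parameters *)

(* With x = log2 (log2 n) / h, the choice is b ~ sqrt x, d ~ 2 x / log2 x: then
   (b ^ d) ^ h >= log2 n, while b is negligible with respect to x / log2 x. *)
Lemma load_estimate (R : realType) (l M : nat) : exists C : R,
  forall n h : nat, (1 <= h)%N -> h%:R < log2 (log2 (n%:R : R)) ->
  exists b d : nat, (trunc_log 2 n <= b ^ (h * d))%N /\
    (l + M * b.+1 + d)%:R <= max_load_bound n h C.
Proof.
have l2 : 0 < ln 2 :> R by rewrite ln_gt0 // ltr1n.
pose c0 := ln 2 :> R.
exists (l%:R + 2 * M%:R + 1 + M%:R * (M%:R / c0) ^+ 2) => n h h1 hll.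
set ll := log2 (log2 _) in hll.
have hR : 0 < h%:R :> R by rewrite ltr0n.
have ln2n0 : 0 < log2 (n%:R : R).
  rewrite ltNge; apply/negP => /ln0 ln0; move: hll; rewrite /ll {1}/log2 ln0 mul0r.
  by rewrite ltNge ltW.
have n0 : (0 < n)%N by case: (n) ln2n0 => //; rewrite /log2 ln0 // mul0r ltxx.
pose x := ll / h%:R; have x1 : 1 < x by rewrite /x ltr_pdivlMr ?mul1r.
pose y := Num.sqrt x; have y2 : x = y ^+ 2 by rewrite sqr_sqrtr // ltW // (lt_trans _ x1).
have x0 : 0 < x by exact: lt_trans x1.
have y1 : 1 < y by rewrite /y -[ltLHS]sqrtr1 ltr_sqrt.
have y0 : 0 < y by exact: lt_trans y1.
have lny : 0 < ln y by rewrite ln_gt0.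
pose z := y ^+ 2 * c0 / (2 * ln y).
have zE : ll / (h%:R * log2 (ll / h%:R)) = z.
  rewrite -/x {1}y2 {1}/log2 lnXn // /z -y2 /x -(mulr_natl (ln y)) -/c0; field.
  by rewrite !gt_eqF.
have z0 : 0 < z by rewrite /z divr_gt0 ?mulr_gt0 ?exprn_gt0.
have /andP[b1 b2] := Num.Theory.truncn_itv (ltW y0).
have z20 : 0 <= 2 * z by rewrite mulr_ge0 // ltW.
have /andP[d1 d2] := Num.Theory.truncn_itv z20.
set b := (Num.truncn y) in b1 b2; set d := (Num.truncn (2 * z)) in d1 d2.
(* The successors exceed y and 2z, and y^(2zh) = 2^(xh) = log2 n. *)
exists b.+1, d.+1; split.
  have lbd : log2 (n%:R : R) <= (b.+1 ^ (h * d.+1))%:R.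
    rewrite -ler_ln ?posrE ?ltr0n ?expn_gt0 // natrX lnXn ?ltr0n //.
    have -> : ln (log2 (n%:R : R)) = h%:R * (2 * z) * ln y.
      have -> : ln (log2 (n%:R : R)) = ll * c0 by rewrite /ll {1}/log2 divfK // gt_eqF.
      have -> : ll = h%:R * y ^+ 2 by rewrite -y2 /x mulrC divfK // gt_eqF.
      by rewrite /z; field; rewrite gt_eqF.
    rewrite -[leRHS]mulr_natl natrM; apply: ler_pM.
    - by rewrite mulr_ge0.
    - exact: ltW.
    - by rewrite ler_pM2l // ltW.
    - by rewrite ler_ln ?posrE ?ltr0n // ltW.
  rewrite -(ler_nat R); apply: le_trans lbd.
  rewrite /log2 ler_pdivlMr // mulr_natl -lnXn // -natrX ler_ln ?posrE ?ltr0n ?expn_gt0 //.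
  by rewrite ler_nat trunc_logP.
rewrite /max_load_bound -/ll zE.
(* The factor 6 is 2z from [d] plus 4z from [M] y: as ln y <= 2u, 4z >= c0 u^3, which dominates M
   u^2 up to a constant. *)
pose u := Num.sqrt y; have u2 : y = u ^+ 2 by rewrite sqr_sqrtr // ltW.
have u0 : 0 < u by rewrite sqrtr_gt0.
have zu : c0 * u ^+ 3 <= 4 * z.
  have lu : ln y <= 2 * u.
    by rewrite u2 lnXn // -(mulr_natl (ln u)) ler_pM2l // ltW // ln_sublinear.
  rewrite /z mulrA ler_pdivlMr ?mulr_gt0 // u2.
  have -> : 4 * ((u ^+ 2) ^+ 2 * c0) = c0 * u ^+ 3 * (2 * (2 * u)) by ring.
  by rewrite ler_pM2l ?mulr_gt0 ?exprn_gt0 // ler_pM2l // -u2.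
have Mu : M%:R * u ^+ 2 <= c0 * u ^+ 3 + M%:R * (M%:R / c0) ^+ 2.
  case: (leP (M%:R / c0) u) => Mu.
    apply: ler_wpDr; first by rewrite mulr_ge0 ?exprn_ge0 ?divr_ge0 // ltW.
    have -> : c0 * u ^+ 3 = (c0 * u) * u ^+ 2 by ring.
    rewrite ler_wpM2r ?sqr_ge0 //.
    by rewrite mulrC -ler_pdivrMr.
  apply: ler_wpDl; first by rewrite mulr_ge0 ?exprn_ge0 // ltW.
  by rewrite ler_wpM2l // lerXn2r ?nnegrE ?divr_ge0 // ltW.
have Mb : M%:R * b%:R <= M%:R * u ^+ 2 by rewrite ler_wpM2l // -u2.
rewrite !natrD natrM -[b.+2]addn2 natrD -[d.+1]addn1 natrD mulrDr.
rewrite -/c0; lra.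
Qed.

(** * From runs of the algorithm to the probability bound *)

Lemma run_history n m h (A : state n -> bin_pair n -> state n) (w : m.-tuple (bin_pair n)) :
  insertion_algorithm h A -> history h w (fun i => run A (take i w)).
Proof.
move=> HA; split=> [|i]; first by rewrite take0.
have iw : (i < size w)%N by rewrite size_tuple.
rewrite (take_nth (tnth w i)) // /run -cats1 foldl_cat /= -tnth_nth; exact: HA.
Qed.

Theorem theorem4 (R : realType) (s : R) (hs : 0 < s) (c : R) (hc : 0 < c) :
  exists C K : R,
    forall (n h : nat) (A : state n -> bin_pair n -> state n),
      (1 <= h)%N -> h%:R < log2 (log2 (n%:R : R)) ->
      insertion_algorithm h A ->
      let m := Num.truncn (s * n%:R / 2) in
      1 - K / (n%:R `^ c) <=
        Prob R (fun w : m.-tuple (bin_pair n) =>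
                  all_loads_le A (max_load_bound n h C) w).
Proof.
(* [sigma] bounds m / n, and [q] is an integer above c. *)
pose sigma := (Num.truncn (s / 2)).+1; pose q := (Num.truncn c).+1.
have [t [l [K HK]]] := prob_sparse_thin R q (isT : (0 < sigma)%N).
have [C HC] := load_estimate R l t.+1.*2.
exists C, `|K| => n h A h1 hll HA; cbv zeta; set m := Num.truncn _.
(* For n <= 1 the double logarithm is 0, as [ln] vanishes at nonpositive arguments, so no [h]
   fits. *)
have n1 : (1 < n)%N.
  rewrite ltnNge; apply/negP => n1.
  have /ln0 ln0n : log2 (n%:R : R) <= 0.
    by rewrite pmulr_lle0 ?invr_gt0 ?ln_gt0 ?ltr1n // ln_le0 // lern1.
  by move: hll; rewrite {1}/log2 ln0n mul0r ltNge ler0n.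
have n0 : 0 < n%:R :> R by rewrite ltr0n ltnW.
have mn : (m <= sigma * n)%N.
  rewrite -(ler_nat R) natrM; apply: (@le_trans _ _ (s * n%:R / 2)).
    by rewrite /m truncn_le // divr_ge0 ?mulr_ge0 // ltW.
  by rewrite mulrAC ler_wpM2r // ltW // truncnS_gt.
have [b [d [bd lC]]] := HC n h h1 hll.
apply: (@le_trans _ _ (1 - K / n%:R ^+ q)).
  rewrite lerD2l lerN2; apply: (@le_trans _ _ (`|K| / n%:R ^+ q)).
    by rewrite ler_wpM2r ?invr_ge0 ?exprn_ge0 // ler_norm.
  rewrite ler_wpM2l // lef_pV2 ?posrE ?exprn_gt0 ?powR_gt0 // -powR_mulrn //.
  by apply: ler_powR; [rewrite ler1n ltnW|rewrite ltW // truncnS_gt].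
apply: le_trans (HK n m n1 mn) _; apply: prob_le => w.
case/andP=> /forallP sparse /forallP thin; have hist := run_history w HA.
apply/forallP => i; apply/forallP => X; rewrite leNgt; apply/negP => over.
have k0 : (0 < trunc_log 2 n)%N by rewrite trunc_log_gt0.
have : (l + t.+1.*2 * b.+1 + d <= load (run A (take m w)) X)%N.
  apply: leq_trans (history_load hist X (leq_ord i) (leqnn m)).
  by rewrite -(ler_nat R); apply/ltW/(le_lt_trans lC).
move=> /(overload_bound h1 k0 hist) bound.
suff : (b ^ (h * d) < trunc_log 2 n)%N by rewrite ltnNge bd.
apply: bound => [Q Qk|Q /eqP Qk Qin]; first exact: implyP (sparse Q) Qk.
by have /implyP/(_ Qk)/implyP/(_ Qin) := thin Q.
Qed.
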